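(* Consider the complex 3-dimensional Novikov algebras $D_1$ and $D_2(\alpha)$ $(\alpha\in\mathbb{C})$ given by the products listed in the context. For an algebra $A$ and an algebra $B$ from this list, $B$ lies in $\partial O(A)$ if and only if $A=D_1$ and $B=D_2(-1)$. That is, the only algebra of this list in $\partial O(D_1)$ is $D_2(-1)$, and for every $\alpha\in\mathbb{C}$ no algebra of this list lies in $\partial O(D_2(\alpha))$.
   Context: A Novikov algebra over $\mathbb{C}$ is a complex vector space with a bilinear product satisfying $(x\cdot y)\cdot z-x\cdot(y\cdot z)=(y\cdot x)\cdot z-y\cdot(x\cdot z)$ and $(x\cdot y)\cdot z=(x\cdot z)\cdot y$ for all $x,y,z$. Fix a 3-dimensional complex vector space $V$ with basis $(e_1,e_2,e_3)$. The set of Novikov products on $V$, identified with their structure constants in $\mathbb{C}^{27}$, is an affine algebraic set, on which $GL_3(\mathbb{C})$ acts by $(g\circ\mu)(x,y)=g(\mu(g^{-1}x,g^{-1}y))$. For a 3-dimensional Novikov algebra $A$, $O(A)$ is the orbit of a structure representing $A$, $\overline{O(A)}$ its Zariski closure, and $\partial O(A)=\overline{O(A)}\setminus O(A)$; ''$B$ lies in $\partial O(A)$'' means that a structure representing $B$ lies in $\partial O(A)$. The algebras (basis $e_1,e_2,e_3$; products of basis vectors not listed are zero); they are pairwise non-isomorphic: $D_1$: $e_1e_1=-e_1+e_3$, $e_1e_3=e_2$, $e_2e_1=-e_2$, $e_3e_1=-e_3$. $D_2(\alpha)$: $e_1e_1=\alpha e_1$, $e_1e_2=(\alpha+1)e_2$,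 $e_1e_3=e_2+(\alpha+1)e_3$, $e_2e_1=\alpha e_2$, $e_3e_1=\alpha e_3$. *)

(* Defs.v *)
From mathcomp Require Import all_boot all_order all_algebra.
From mathcomp Require Import classical_sets reals.
From mathcomp Require Import complex mpoly ring.

Set Implicit Arguments.
Unset Strict Implicit.
Unset Printing Implicit Defensive.

Import GRing.Theory.

Local Open Scope classical_set_scope.
Local Open Scope ring_scope.

Section Novikov.
Variable K : fieldType.

(* mu (i, j, k) is the coefficient of e_k in the product e_i e_j. *)
Definition structure_constants := {ffun 'I_3 * 'I_3 * 'I_3 -> K}.

Definition basis_vector (i : 'I_3) : 'cV[K]_3 := delta_mx i 0.

Definition product (mu : structure_constants) (x y : 'cV[K]_3) : 'cV[K]_3 :=
  \col_k \sum_i \sum_j x i 0 * y j 0 * mu (i, j, k).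

Definition constants_of_table (T : 'I_3 -> 'I_3 -> 'cV[K]_3) :
    structure_constants :=
  [ffun t : 'I_3 * 'I_3 * 'I_3 => T t.1.1 t.1.2 t.2 0].

Definition is_novikov (mu : structure_constants) : Prop :=
  let m := product mu in
  (forall x y z, m (m x y) z - m x (m y z) = m (m y x) z - m y (m x z)) /\
  (forall x y z, m (m x y) z = m (m x z) y).

Record novikov := Novikov {
  novikov_constants :> structure_constants;
  novikovP : is_novikov novikov_constants }.

Definition gl_action (g : 'M[K]_3) (mu : structure_constants) :
    structure_constants :=
  constants_of_table (fun i j =>
    g *m product mu (invmx g *m basis_vector i) (invmx g *m basis_vector j)).

Definition orbit (mu : structure_constants) : set structure_constants :=
  [set nu | exists2 g : 'M[K]_3, g \in unitmx & nu = gl_action g mu].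

Notation nb_constants := #|{: 'I_3 * 'I_3 * 'I_3}|.

Definition zariski_closed (Z : set structure_constants) : Prop :=
  exists P : set {mpoly K[nb_constants]},
    Z = [set mu | forall p, P p -> p.@[fun t => mu (enum_val t)] = 0].

Definition zariski_closure (S : set structure_constants) :
    set structure_constants :=
  smallest zariski_closed S.

Definition orbit_boundary (A : novikov) : set structure_constants :=
  zariski_closure (orbit A) `\` orbit A.

(* The structures representing B are exactly the elements of its orbit. *)
Definition lies_in_boundary (B A : novikov) : Prop :=
  exists2 mu, orbit B mu & orbit_boundary A mu.

Local Notation e1 := (basis_vector 0).
Local Notation e2 := (basis_vector 1).
Local Notation e3 := (basis_vector 2).

Definition D1_table (i j : 'I_3) : 'cV[K]_3 :=
  match val i, val j with
  | 0%N, 0%N => - e1 + e3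
  | 0%N, 2%N => e2
  | 1%N, 0%N => - e2
  | 2%N, 0%N => - e3
  | _, _ => 0
  end.

Definition D2_table (a : K) (i j : 'I_3) : 'cV[K]_3 :=
  match val i, val j with
  | 0%N, 0%N => a *: e1
  | 0%N, 1%N => (a + 1) *: e2
  | 0%N, 2%N => e2 + (a + 1) *: e3
  | 1%N, 0%N => a *: e2
  | 2%N, 0%N => a *: e3
  | _, _ => 0
  end.

Let ordE (k : 'I_3) : k = if k == 0 then 0 else if k == 1 then 1 else 2.
Proof. by apply/val_inj; case: k => [[|[|[|//]]] ?]. Qed.

Let sum3 (F : 'I_3 -> K) : \sum_i F i = F 0 + F 1 + F 2.
Proof.
rewrite !big_ord_recl big_ord0 addr0 addrA.
by congr (F _ + F _ + F _); apply/val_inj.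
Qed.

Lemma D1_product (x y : 'cV[K]_3) :
  product (constants_of_table D1_table) x y =
  - y 0 0 *: x + (x 0 0 * y 2 0) *: e2 + (x 0 0 * y 0 0) *: e3.
Proof.
apply/colP => k; rewrite !mxE.
transitivity (\sum_i \sum_j x i 0 * y j 0 * D1_table i j k 0).
  by apply: eq_bigr => i _; apply: eq_bigr => j _; rewrite ffunE.
do !rewrite sum3; rewrite /D1_table /= !mxE.
by case: k => [[|[|[|//]]] lt_k3]; rewrite [Ordinal lt_k3]ordE /=; ring.
Qed.

Lemma D1_novikov : is_novikov (constants_of_table D1_table).
Proof.
split=> x y z; rewrite !D1_product; apply/colP;
  by case=> [[|[|[|//]]] lt_k3]; rewrite [Ordinal lt_k3]ordE !mxE /=; ring.
Qed.

Lemma D2_product (a : K) (x y : 'cV[K]_3) :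
  product (constants_of_table (D2_table a)) x y =
  (a * y 0 0) *: x + (x 0 0 * ((a + 1) * y 1 0 + y 2 0)) *: e2 +
  (x 0 0 * ((a + 1) * y 2 0)) *: e3.
Proof.
apply/colP => k; rewrite !mxE.
transitivity (\sum_i \sum_j x i 0 * y j 0 * D2_table a i j k 0).
  by apply: eq_bigr => i _; apply: eq_bigr => j _; rewrite ffunE.
do !rewrite sum3; rewrite /D2_table /= !mxE.
by case: k => [[|[|[|//]]] lt_k3]; rewrite [Ordinal lt_k3]ordE /=; ring.
Qed.

Lemma D2_novikov (a : K) : is_novikov (constants_of_table (D2_table a)).
Proof.
split=> x y z; rewrite !D2_product; apply/colP;
  by case=> [[|[|[|//]]] lt_k3]; rewrite [Ordinal lt_k3]ordE !mxE /=; ring.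
Qed.

Inductive label := D1 | D2 (a : K).

Definition algebra (l : label) : novikov :=
  match l with
  | D1 => Novikov D1_novikov
  | D2 a => Novikov (D2_novikov a)
  end.

End Novikov.

Arguments D1 {K}.

(* Main.v *)
Require Import Defs.
From mathcomp Require Import all_boot all_order all_algebra.
From mathcomp Require Import reals complex.
From mathcomp Require Import classical_sets mpoly ring.

Set Implicit Arguments.
Unset Strict Implicit.
Unset Printing Implicit Defensive.

Import GRing.Theory Num.Theory.

Local Open Scope ring_scope.

(** Write L_x and R_x for left and right multiplication by x, and x_1 for the
    first coordinate of x. The products are
      D_1 :    x y = - y_1 x + x_1 y_3 e_2 + x_1 y_1 e_3,
      D_2(a) : x y = a y_1 x + x_1 ((a + 1) y_2 + y_3) e_2
                     + (a + 1) x_1 y_3 e_3,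
    so that D_1 differs from D_2(-1) only by the term x_1 y_1 e_3.

    A condition on structure constants that is Zariski closed and invariant
    under GL_3 passes from an algebra to everything in the closure of its orbit
    ([boundary_invariant]). Two such conditions rule out all the forbidden
    degenerations.

    - The linear functions tr L_x and tr R_x are (3 a + 2) x_1 and 3 a x_1 on
      D_2(a), and - x_1 and - 3 x_1 on D_1. The relation
      3 a tr L_x = (3 a + 2) tr R_x therefore determines a within the family
      D_2, and on D_1 it holds exactly when a = -1. Hence neither D_2(b) with
      b <> a nor, unless a = -1, D_1 lies in the closure of the orbit of
      D_2(a), and no D_2(b) with b <> -1 lies in that of D_1.

    - The traces do not separate D_1 from D_2(-1). The identity
      x (x x) = tr(L_x) (x x) does: in both algebras tr L_x = - x_1, and
      x (x x) + x_1 (x x) is 0 in D_2(-1) but x_1^3 e_2 in D_1. Hence D_1 is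
      not in the closure of the orbit of D_2(-1). Being invariant, the identity
      also shows that D_2(-1) and D_1 are not isomorphic.

    Finally D_2(-1) is in the closure of the orbit of D_1: for t <> 0 the change
    of basis diag(1, t, t) turns D_1 into the same product with x_1 y_1 e_3
    multiplied by t, which is a point of the line through D_2(-1) and D_1
    ([line_through_D1]). A polynomial that vanishes on a line away from t = 0
    also vanishes at t = 0 ([closed_line]). *)

(** * Multiplication operators and transport of structure *)

Section Structures.
Variable K : fieldType.
Implicit Types (mu nu : structure_constants K) (x y : 'cV[K]_3).
Implicit Types (g : 'M[K]_3).

Definition left_mult mu x : 'M[K]_3 :=
  \matrix_(k, j) \sum_i x i 0 * mu (i, j, k).

Definition right_mult mu y : 'M[K]_3 :=
  \matrix_(k, i) \sum_j y j 0 * mu (i, j, k).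

Lemma left_multE mu x y : left_mult mu x *m y = product mu x y.
Proof.
apply/colP => k; rewrite !mxE exchange_big /=; apply: eq_bigr => j _.
by rewrite !mxE mulr_suml; apply: eq_bigr => i _; ring.
Qed.

Lemma right_multE mu x y : right_mult mu y *m x = product mu x y.
Proof.
apply/colP => k; rewrite !mxE; apply: eq_bigr => i _.
by rewrite !mxE mulr_suml; apply: eq_bigr => j _; ring.
Qed.

Lemma eq_mx_mulcol g h : (forall x, g *m x = h *m x) -> g = h.
Proof.
move=> eq_gh; apply/matrixP => i j.
have /colP/(_ i) := eq_gh (delta_mx j 0).
by rewrite -!colE !mxE.
Qed.

Lemma cV_basis_sum x : x = \sum_i x i 0 *: basis_vector K i.
Proof.
by rewrite {1}[x]matrix_sum_delta; apply: eq_bigr => i _; rewrite big_ord1.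
Qed.

Lemma product_table (T : 'I_3 -> 'I_3 -> 'cV[K]_3) x y :
  product (constants_of_table T) x y =
  \sum_i \sum_j (x i 0 * y j 0) *: T i j.
Proof.
apply/colP => k; rewrite mxE summxE; apply: eq_bigr => i _.
by rewrite summxE; apply: eq_bigr => j _; rewrite ffunE mxE.
Qed.

(** [gl_action] is defined by its values on basis vectors; bilinearity extends
    the formula to all vectors. *)
Lemma product_gl_action g mu x y :
  product (gl_action g mu) x y =
  g *m product mu (invmx g *m x) (invmx g *m y).
Proof.
rewrite product_table {2}(cV_basis_sum x) mulmx_sumr -right_multE !mulmx_sumr.
apply: eq_bigr => i _; rewrite -scalemxAr -scalemxAr right_multE.
rewrite -left_multE {2}(cV_basis_sum y) !mulmx_sumr.
rewrite -scalemxAr mulmx_sumr scaler_sumr; apply: eq_bigr => j _.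
by rewrite -!scalemxAr left_multE scalerA.
Qed.

Lemma product_basis mu i j k :
  product mu (basis_vector K i) (basis_vector K j) k 0 = mu (i, j, k).
Proof.
rewrite mxE (bigD1 i) //= (bigD1 j) //= !mxE !eqxx !mul1r.
rewrite !big1 ?addr0 // => [i' ne_i | j' ne_j].
  by apply: big1 => j' _; rewrite !mxE (negPf ne_i) !mul0r.
by rewrite !mxE (negPf ne_j) mulr0 mul0r.
Qed.

Lemma eq_product mu nu :
  (forall x y, product mu x y = product nu x y) -> mu = nu.
Proof.
by move=> eq_mn; apply/ffunP => -[[i j] k]; rewrite -!product_basis eq_mn.
Qed.

(** Membership in an orbit, phrased as an isomorphism so that no inverse matrix
    has to be computed. *)
Lemma orbit_morphism g mu nu : g \in unitmx ->
  (forall x y, product nu (g *m x) (g *m y) = g *m product mu x y) ->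
  Defs.orbit mu nu.
Proof.
move=> g_unit g_hom; exists g => //; apply: eq_product => x y.
by rewrite product_gl_action -g_hom !mulKVmx.
Qed.

Lemma orbit_refl mu : Defs.orbit mu mu.
Proof.
by apply: (@orbit_morphism 1%:M); rewrite ?unitmx1 // => x y; rewrite !mul1mx.
Qed.

Lemma left_mult_gl g mu x :
  left_mult (gl_action g mu) x = g *m left_mult mu (invmx g *m x) *m invmx g.
Proof.
apply: eq_mx_mulcol => y.
by rewrite left_multE product_gl_action -!mulmxA left_multE.
Qed.

Lemma right_mult_gl g mu y :
  right_mult (gl_action g mu) y = g *m right_mult mu (invmx g *m y) *m invmx g.
Proof.
apply: eq_mx_mulcol => x.
by rewrite right_multE product_gl_action -!mulmxA right_multE.
Qed.

Lemma mxtrace_conj g (h : 'M[K]_3) :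
  g \in unitmx -> \tr (g *m h *m invmx g) = \tr h.
Proof. by move=> g_unit; rewrite mxtrace_mulC mulKmx. Qed.

Lemma mxtrace_basis g : \tr g = \sum_k (g *m basis_vector K k) k 0.
Proof. by apply: eq_bigr => k _; rewrite -colE mxE. Qed.

(** * Closed invariant conditions *)

(** Closed sets are zero sets of elements of [mpoly] in the numbered variables;
    reasoning about functions of the structure constants instead lets the
    conditions below be read directly off their formulas. *)
Definition polynomial_function (F : structure_constants K -> K) : Prop :=
  exists p : {mpoly K[#|{: 'I_3 * 'I_3 * 'I_3}|]},
    forall mu, F mu = p.@[fun t => mu (enum_val t)].

Lemma poly_fun_coord s : polynomial_function (fun mu => mu s).
Proof. by exists 'X_(enum_rank s) => mu; rewrite mevalXU enum_rankK. Qed.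

Lemma poly_fun_const c : polynomial_function (fun=> c).
Proof. by exists c%:MP => mu; rewrite mevalC. Qed.

Lemma poly_funD F G : polynomial_function F -> polynomial_function G ->
  polynomial_function (fun mu => F mu + G mu).
Proof. by move=> [p Fp] [q Gq]; exists (p + q) => mu; rewrite mevalD Fp Gq. Qed.

Lemma poly_funM F G : polynomial_function F -> polynomial_function G ->
  polynomial_function (fun mu => F mu * G mu).
Proof. by move=> [p Fp] [q Gq]; exists (p * q) => mu; rewrite mevalM Fp Gq. Qed.

Lemma poly_funB F G : polynomial_function F -> polynomial_function G ->
  polynomial_function (fun mu => F mu - G mu).
Proof. by move=> [p Fp] [q Gq]; exists (p - q) => mu; rewrite mevalB Fp Gq. Qed.

Lemma poly_fun_sum (I : finType) (F : structure_constants K -> I -> K) :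
  (forall i, polynomial_function (F^~ i)) ->
  polynomial_function (fun mu => \sum_i F mu i).
Proof.
move=> /fin_all_exists[p Fp]; exists (\sum_i p i) => mu.
by rewrite raddf_sum /=; apply: eq_bigr => i _; rewrite Fp.
Qed.

(** The arguments may themselves depend on the structure constants: this is what
    makes iterated products polynomial. *)
Lemma poly_fun_product (x y : structure_constants K -> 'cV[K]_3) k :
  (forall i, polynomial_function (fun mu => x mu i 0)) ->
  (forall i, polynomial_function (fun mu => y mu i 0)) ->
  polynomial_function (fun mu => product mu (x mu) (y mu) k 0).
Proof.
move=> x_poly y_poly.
have [p px] : polynomial_function
    (fun mu => \sum_i \sum_j x mu i 0 * y mu j 0 * mu (i, j, k)).
  apply: poly_fun_sum => i; apply: poly_fun_sum => j.
  by apply: poly_funM; [apply: poly_funM | apply: poly_fun_coord].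
by exists p => mu; rewrite -px mxE.
Qed.

Lemma poly_fun_trace_left x :
  polynomial_function (fun mu => \tr (left_mult mu x)).
Proof.
have [p px] : polynomial_function
    (fun mu => \sum_k product mu x (basis_vector K k) k 0).
  by apply: poly_fun_sum => k; apply: poly_fun_product => i;
    apply: poly_fun_const.
exists p => mu; rewrite -px mxtrace_basis.
by apply: eq_bigr => k _; rewrite left_multE.
Qed.

Lemma poly_fun_trace_right x :
  polynomial_function (fun mu => \tr (right_mult mu x)).
Proof.
have [p px] : polynomial_function
    (fun mu => \sum_k product mu (basis_vector K k) x k 0).
  by apply: poly_fun_sum => k; apply: poly_fun_product => i;
    apply: poly_fun_const.
exists p => mu; rewrite -px mxtrace_basis.
by apply: eq_bigr => k _; rewrite right_multE.
Qed.

Lemma zariski_closed_zeros (I : Type) (F : I -> structure_constants K -> K) :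
  (forall i, polynomial_function (F i)) ->
  zariski_closed [set mu | forall i, F i mu = 0]%classic.
Proof.
move=> F_poly.
exists [set p | exists i, forall mu, F i mu = p.@[fun t => mu (enum_val t)]]%classic.
apply/seteqP; split=> mu /= F0.
  by move=> p [i Fp]; rewrite -Fp.
by move=> i; have [p Fp] := F_poly i; rewrite Fp; apply: F0; exists i.
Qed.

Definition gl_invariant (Z : set (structure_constants K)) : Prop :=
  forall g mu, g \in unitmx -> Z (gl_action g mu) <-> Z mu.

(** An invariant condition satisfied by A holds on the whole orbit of A, hence on
    its closure, hence at some structure in the orbit of B, and invariance brings
    it back to B. *)
Lemma boundary_invariant (Z : set (structure_constants K)) (A B : novikov K) :
  zariski_closed Z -> gl_invariant Z -> lies_in_boundary B A -> Z A -> Z B.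
Proof.
move=> Z_closed Z_inv [_ [g g_unit ->] [clA _]] ZA; apply/(Z_inv g) => //.
by apply: clA; split=> // _ [h h_unit ->]; apply/Z_inv.
Qed.

Definition trace_relation (a b : K) : set (structure_constants K) :=
  [set mu | forall x,
     a * \tr (left_mult mu x) - b * \tr (right_mult mu x) = 0]%classic.

Lemma trace_relation_closed a b : zariski_closed (trace_relation a b).
Proof.
apply: zariski_closed_zeros => x; apply: poly_funB.
  by apply: poly_funM (poly_fun_const _) (poly_fun_trace_left _).
by apply: poly_funM (poly_fun_const _) (poly_fun_trace_right _).
Qed.

(** Multiplication operators are conjugated by g, and their traces are
    unchanged. *)
Lemma trace_relation_invariant a b : gl_invariant (trace_relation a b).
Proof.
move=> g mu g_unit; split=> rel x.
  have := rel (g *m x).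
  by rewrite left_mult_gl right_mult_gl !mxtrace_conj // mulKmx.
by rewrite left_mult_gl right_mult_gl !mxtrace_conj.
Qed.

(** On D_1 and D_2(-1) the trace is - x_1, which makes it a basis-free substitute
    for that coordinate in x (x x) = - x_1 (x x). *)
Definition cubic_identity : set (structure_constants K) :=
  [set mu | forall x, product mu x (product mu x x) =
                      \tr (left_mult mu x) *: product mu x x]%classic.

Lemma cubic_identity_closed : zariski_closed cubic_identity.
Proof.
(* One equation for each vector x and each coordinate k. *)
pose F (s : 'cV[K]_3 * 'I_3) mu := product mu s.1 (product mu s.1 s.1) s.2 0 -
  \tr (left_mult mu s.1) * product mu s.1 s.1 s.2 0.
have -> : cubic_identity = [set mu | forall s, F s mu = 0]%classic.
  apply/seteqP; split=> mu /= idmu.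
    by move=> [x k]; rewrite /F /= idmu mxE subrr.
  by move=> x; apply/colP => k; rewrite [RHS]mxE;
    apply/subr0_eq/(idmu (x, k)).
have sq_poly x k : polynomial_function (fun mu => product mu x x k 0).
  by apply: poly_fun_product => i; apply: poly_fun_const.
apply: zariski_closed_zeros => -[x k]; apply: poly_funB.
  by apply: (@poly_fun_product (fun=> x)) => i; [apply: poly_fun_const | apply: sq_poly].
exact: poly_funM (poly_fun_trace_left x) (sq_poly x k).
Qed.

Lemma cubic_identity_invariant : gl_invariant cubic_identity.
Proof.
move=> g mu g_unit; split=> idmu x; last first.
  rewrite left_mult_gl mxtrace_conj // !product_gl_action mulKmx // idmu.
  by rewrite -scalemxAr.
have := idmu (g *m x).
rewrite left_mult_gl mxtrace_conj // !product_gl_action !mulKmx //.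
by rewrite scalemxAr => /(can_inj (mulKmx g_unit)).
Qed.

(** * Values of the invariants on D_1 and D_2(a) *)

Lemma sum_ord3 (F : 'I_3 -> K) : \sum_i F i = F 0 + F 1 + F 2.
Proof.
rewrite !big_ord_recl big_ord0 addr0 addrA.
by congr (F _ + F _ + F _); apply/val_inj.
Qed.

Lemma colP3 x y :
  x 0 0 = y 0 0 -> x 1 0 = y 1 0 -> x 2 0 = y 2 0 -> x = y.
Proof.
move=> eq0 eq1 eq2; apply/colP => -[[|[|[|//]]] lt_k3].
- by rewrite (_ : Ordinal _ = 0) //; apply/val_inj.
- by rewrite (_ : Ordinal _ = 1) //; apply/val_inj.
by rewrite (_ : Ordinal _ = 2) //; apply/val_inj.
Qed.

Lemma trace_left_D1 x :
  \tr (left_mult (constants_of_table (@D1_table K)) x) = - x 0 0.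
Proof.
rewrite mxtrace_basis sum_ord3 !left_multE !D1_product !mxE /=; ring.
Qed.

Lemma trace_right_D1 x :
  \tr (right_mult (constants_of_table (@D1_table K)) x) = - 3 * x 0 0.
Proof.
rewrite mxtrace_basis sum_ord3 !right_multE !D1_product !mxE /=; ring.
Qed.

Lemma trace_left_D2 a x :
  \tr (left_mult (constants_of_table (D2_table a)) x) = (3 * a + 2) * x 0 0.
Proof.
rewrite mxtrace_basis sum_ord3 !left_multE !D2_product !mxE /=; ring.
Qed.

Lemma trace_right_D2 a x :
  \tr (right_mult (constants_of_table (D2_table a)) x) = 3 * a * x 0 0.
Proof.
rewrite mxtrace_basis sum_ord3 !right_multE !D2_product !mxE /=; ring.
Qed.

Lemma cubic_identity_D2 : cubic_identity (algebra (D2 (-1 : K))).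
Proof.
move=> x /=; rewrite trace_left_D2 !D2_product.
by apply: colP3; rewrite !mxE /=; ring.
Qed.

(** At x = e_1 one has x x = - e_1 + e_3 and x (x x) = e_1 + e_2 - e_3, with
    tr L_x = -1: the two sides differ by e_2. *)
Lemma not_cubic_identity_D1 : ~ cubic_identity (algebra (@D1 K)).
Proof.
move=> /(_ (basis_vector K 0)) /= /colP/(_ 1).
rewrite trace_left_D1 !D1_product !mxE /= => /eqP.
rewrite -subr_eq0 (_ : _ - _ = 1) ?oner_eq0 //; ring.
Qed.

Lemma trace_relation_D1 :
  trace_relation (3 * -1) (3 * -1 + 2) (algebra (@D1 K)).
Proof. by move=> x /=; rewrite trace_left_D1 trace_right_D1; ring. Qed.

Lemma trace_relation_D2 (a : K) :
  trace_relation (3 * a) (3 * a + 2) (algebra (D2 a)).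
Proof. by move=> x /=; rewrite trace_left_D2 trace_right_D2; ring. Qed.

(** At x = e_1 the relation of parameter a reads
    3 a (3 b + 2) - (3 a + 2) 3 b = 6 (a - b) on D_2(b). *)
Lemma trace_relation_D2_inj (a b : K) : 6 != 0 :> K ->
  trace_relation (3 * a) (3 * a + 2) (algebra (D2 b)) -> b = a.
Proof.
move=> nz6 /(_ (basis_vector K 0)) /=.
rewrite trace_left_D2 trace_right_D2 mxE /= => rel.
apply/esym/eqP; rewrite -subr_eq0 -(mulrI_eq0 _ (mulfI nz6)) -rel; apply/eqP.
ring.
Qed.

(** At x = e_1 the left-hand side is - 3 a + 3 (3 a + 2) = 6 (a + 1). *)
Lemma trace_relation_D2_D1 (a : K) : 6 != 0 :> K ->
  trace_relation (3 * a) (3 * a + 2) (algebra D1) -> a = -1.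
Proof.
move=> nz6 /(_ (basis_vector K 0)) /=.
rewrite trace_left_D1 trace_right_D1 mxE /= => rel.
apply/eqP; rewrite -subr_eq0 -(mulrI_eq0 _ (mulfI nz6)) -rel; apply/eqP.
ring.
Qed.

(** * The degeneration of D_1 to D_2(-1) *)

Definition line mu nu (t : K) : structure_constants K :=
  [ffun s => (1 - t) * mu s + t * nu s].

Lemma line_product mu nu t x y :
  product (line mu nu t) x y =
  (1 - t) *: product mu x y + t *: product nu x y.
Proof.
apply/colP => k; rewrite !mxE !mulr_sumr -big_split; apply: eq_bigr => i _.
rewrite !mulr_sumr -big_split; apply: eq_bigr => j _ /=.
by rewrite ffunE; ring.
Qed.

Lemma meval_line (p : {mpoly K[#|{: 'I_3 * 'I_3 * 'I_3}|]}) mu nu :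
  exists q : {poly K},
    forall t, p.@[fun s => line mu nu t (enum_val s)] = q.[t].
Proof.
exists (\sum_(m <- msupp p) p@_m *: \prod_s
  ((1 - 'X) * (mu (enum_val s))%:P + 'X * (nu (enum_val s))%:P) ^+ m s) => t.
rewrite mevalE horner_sum; apply: eq_bigr => m _.
rewrite hornerZ horner_prod; congr (_ * _); apply: eq_bigr => s _.
by rewrite horner_exp !hornerE ffunE.
Qed.

(** The point of parameter t has the product of D_1 with x_1 y_1 e_3 multiplied
    by t, and the rescaling of e_2 and e_3 by t creates exactly this factor: the
    equal weights of e_2 and e_3 leave e_1 e_3 = e_2 unchanged, while e_3 in
    e_1 e_1 acquires the factor t. *)
Lemma line_through_D1 (t : K) : t != 0 ->
  Defs.orbit (algebra D1) (line (algebra (D2 (-1))) (algebra D1) t).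
Proof.
move=> nz_t; pose d : 'rV[K]_3 := \row_i if i == 0 then 1 else t.
have gE x i : (diag_mx d *m x) i 0 = (if i == 0 then 1 else t) * x i 0.
  by rewrite mul_diag_mx !mxE.
apply: (@orbit_morphism (diag_mx d)) => [|x y].
  rewrite unitmxE det_diag unitfE; apply/prodf_neq0 => i _.
  by rewrite mxE; case: ifP; rewrite ?oner_neq0.
rewrite line_product /= !D1_product !D2_product.
by have [gx gy] := (gE x, gE y); apply: colP3; rewrite [RHS]gE;
  move: (diag_mx d *m x) (diag_mx d *m y) gx gy => u v gx gy;
  rewrite !mxE !gx !gy /=; ring.
Qed.

End Structures.

(** In characteristic 0 the numbers 1, ..., size q are more roots than the degree
    of a nonzero q allows. *)
Lemma poly_cofinite_roots (K : numFieldType) (q : {poly K}) :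
  (forall t, t != 0 -> q.[t] = 0) -> q = 0.
Proof.
move=> q0; apply: (@roots_geq_poly_eq0 _ _ [seq n.+1%:R | n <- iota 0 (size q)]).
- by apply/allP => _ /mapP[n _ ->]; apply/rootP/q0; rewrite pnatr_eq0.
- rewrite map_inj_uniq ?iota_uniq // => m n /eqP.
  by rewrite eqr_nat eqSS => /eqP.
by rewrite size_map size_iota.
Qed.

Lemma closed_line (K : numFieldType) (Z : set (structure_constants K)) mu nu :
  zariski_closed Z -> (forall t, t != 0 -> Z (line mu nu t)) -> Z mu.
Proof.
move=> [P ->] line_zero p Pp; have [q pq] := meval_line p mu nu.
have q_eq0 : q = 0.
  by apply: poly_cofinite_roots => t /line_zero/(_ p Pp); rewrite pq.
rewrite -[RHS](horner0 0) -q_eq0 -pq.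
by apply: meval_eq => s; rewrite ffunE subr0 mul1r mul0r addr0.
Qed.

(** The closure part is the line above; the cubic identity, true in D_2(-1) and
    false in D_1, keeps D_2(-1) out of the orbit. *)
Lemma D2_boundary_D1 (K : numFieldType) :
  lies_in_boundary (algebra (D2 (-1 : K))) (algebra D1).
Proof.
exists (algebra (D2 (-1))); first exact: orbit_refl.
split=> [Z [Z_closed orbZ] | [g g_unit D2E]].
  apply: (@closed_line _ _ _ (algebra D1) Z_closed) => t nz_t.
  exact: orbZ (line_through_D1 nz_t).
apply: (@not_cubic_identity_D1 K); apply/(cubic_identity_invariant _ g_unit).
by rewrite -D2E; apply: cubic_identity_D2.
Qed.

Lemma boundary_irreflexive (K : fieldType) (A : novikov K) :
  ~ lies_in_boundary A A.
Proof. by move=> [mu orb_mu [_]]. Qed.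

Theorem proposition4p4 (R : realType) (A B : label R[i]) :
  lies_in_boundary (algebra B) (algebra A) <-> A = D1 /\ B = D2 (-1).
Proof.
have nz6 : 6 != 0 :> R[i] by rewrite pnatr_eq0.
split=> [bdBA | [-> ->]]; last exact: D2_boundary_D1.
have trace_BA := boundary_invariant (trace_relation_closed _ _)
  (trace_relation_invariant _ _) bdBA.
case: A B bdBA trace_BA => [|a] [|b] bdBA trace_BA.
- by case: (boundary_irreflexive bdBA).
- by have -> := trace_relation_D2_inj nz6 (trace_BA _ _ (@trace_relation_D1 _)).
- (* The traces leave only D_2(-1), whose orbit closure misses D_1 because of
     the cubic identity. *)
  have a_eq := trace_relation_D2_D1 nz6 (trace_BA _ _ (@trace_relation_D2 _ a)).
  rewrite a_eq in bdBA; case: (@not_cubic_identity_D1 R[i]).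
  apply: (boundary_invariant (@cubic_identity_closed _)
    (@cubic_identity_invariant _) bdBA).
  exact: cubic_identity_D2.
- have ba := trace_relation_D2_inj nz6 (trace_BA _ _ (@trace_relation_D2 _ a)).
  by rewrite ba in bdBA; case: (boundary_irreflexive bdBA).
Qed.
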